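(* Let $1\leq p\leq\infty$ and let $X,Y$ be Banach spaces. A linear operator $T:X\to Y^{*}$ is absolutely mid $p^{*}$-summing if and only if the linear functional $\Phi_{T}$ corresponding to $T$, determined by $\Phi_T(x\otimes y)=\langle y,Tx\rangle$ for $x\in X$, $y\in Y$, belongs to $(X\hat{\otimes}_{\gamma_{p}}Y)^{*}$. In this case, the operator norm of $\Phi_{T}$ coincides with $\pi_{p^{*}}^{mid}(T)$.
   Context: $Z$ denotes a Banach space over $\mathbb{K}$ ($=\mathbb{R}$ or $\mathbb{C}$), $Z^{*}$ its topological dual, $B_Z$ its closed unit ball. $p^{*}$ is the conjugate exponent of $p$ ($1/p+1/p^*=1$). Sequence spaces. For $1\le q<\infty$: $\ell_q(Z)$ is the space of sequences in $Z$ with $\|(z_j)_j\|_q=(\sum_j\|z_j\|^q)^{1/q}<\infty$; $\ell_q^w(Z)$ is the space of sequences with $\|(z_j)_j\|_q^w=\sup_{z^*\in B_{Z^*}}(\sum_j|z^*(z_j)|^q)^{1/q}<\infty$; $\ell_q^{mid}(Z)$ is the space of sequences $(z_j)_j$ in $Z$ such that $\sum_n\sum_j|z_n^*(z_j)|^q<\infty$ for every $(z_n^* )_n\in\ell_q^w(Z^* )$, with norm $\|(z_j)_j\|_q^{mid}=\sup_{(z_n^* )_n\in B_{\ell_q^w(Z^* )}}(\sum_n\sum_j|z_n^*(z_j)|^q)^{1/q}$. For $q=\infty$, $\ell_\infty(Z)=\ell_\infty^w(Z)=\ell_\infty^{mid}(Z)$ is the space of bounded sequences with the sup norm. Finite sequences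 are regarded as infinite sequences extended by zeros. For $u\in X\otimes Y$, $\gamma_p(u)=\inf\{\|(x_j)_{j=1}^n\|_{p^*}^{mid}\,\|(y_j)_{j=1}^n\|_p: u=\sum_{j=1}^n x_j\otimes y_j\}$, and $X\hat\otimes_{\gamma_p}Y$ is the completion of $(X\otimes Y,\gamma_p)$. A linear operator $T:X\to Z$ is absolutely mid $q$-summing, $T\in\Pi_q^{mid}(X,Z)$, if $\hat T:\ell_q^{mid}(X)\to\ell_q(Z)$, $\hat T((x_j)_j)=(Tx_j)_j$, is well defined and continuous; $\pi_q^{mid}(T)=\|\hat T\|$. *)

(* Defs.v *)
From HB Require Import structures.
From mathcomp Require Import all_boot all_order all_algebra.
From mathcomp Require Import all_classical all_reals all_analysis.
From mathcomp Require Import complex.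

Set Implicit Arguments.
Unset Strict Implicit.
Unset Printing Implicit Defensive.

Import Order.TTheory GRing.Theory Num.Theory.
Import numFieldNormedType.Exports.

Local Open Scope classical_set_scope.
Local Open Scope ring_scope.

Inductive scalars := RealScalars | ComplexScalars.

Definition scalar_field (R : realType) (k : scalars) : numFieldType :=
  match k with
  | RealScalars => (R : numFieldType)
  | ComplexScalars => (R[i] : numFieldType)
  end.

Definition real_part (R : realType) (k : scalars) : scalar_field R k -> R :=
  match k with
  | RealScalars => fun a : R => a
  | ComplexScalars => fun a : R[i] => complex.Re a
  end.

Definition of_real (R : realType) (k : scalars) : R -> scalar_field R k :=
  match k with
  | RealScalars => fun a : R => a
  | ComplexScalars => fun a : R => (a%:C)%C
  end.

Section scalar_field_theory.
Context {R : realType} {k : scalars}.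
Local Notation K := (scalar_field R k).
Local Notation re := (@real_part R k).
Local Notation inj := (@of_real R k).

Lemma of_realK : cancel inj re.
Proof. by case: k. Qed.

Lemma real_partK (a : K) : 0 <= a -> inj (re a) = a.
Proof.
case: k a => //= a; rewrite lecE /= => /andP[/eqP + _].
by case: a => x y /= ->.
Qed.

Lemma real_part0 : re 0 = 0.
Proof. by case: k. Qed.

Lemma of_real0 : inj 0 = 0.
Proof. by case: k. Qed.

Lemma of_real1 : inj 1 = 1.
Proof. by case: k. Qed.

Lemma real_partD : {morph re : a b / a + b}.
Proof. by case: k => //= -[a b] [c d]. Qed.

Lemma of_realD : {morph inj : a b / a + b}.
Proof. by case: k => //= a b; rewrite rmorphD. Qed.

Lemma of_realM : {morph inj : a b / a * b}.
Proof. by case: k => //= a b; rewrite rmorphM. Qed.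

Lemma le_of_real (a b : R) : (inj a <= inj b) = (a <= b).
Proof. by case: k => //=; rewrite lecR. Qed.

Lemma le_real_part (a b : K) : a <= b -> re a <= re b.
Proof. by case: k a b => //= a b; rewrite lecE => /andP[]. Qed.

End scalar_field_theory.

(* The norm of a [normedModType K] takes its values in [K]; [rnorm] is the same
   norm read as a real number. *)
Definition rnorm (R : realType) (k : scalars)
  (V : normedModType (scalar_field R k)) (x : V) : R := real_part `|x|.

Section rnorm_theory.
Context {R : realType} {k : scalars}.
Local Notation K := (scalar_field R k).
Implicit Types V : normedModType K.

Lemma of_real_rnorm V (x : V) : of_real k (rnorm x) = `|x|.
Proof. by apply: real_partK; apply: normr_ge0. Qed.

Lemma rnorm_le V (x : V) (r : R) : (rnorm x <= r) = (`|x| <= of_real k r).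
Proof. by rewrite -of_real_rnorm le_of_real. Qed.

Lemma rnorm_ge0 V (x : V) : 0 <= rnorm x.
Proof. by rewrite -(@real_part0 R k); apply: le_real_part. Qed.

Lemma rnorm0 V : rnorm (0 : V) = 0.
Proof. by rewrite /rnorm normr0 real_part0. Qed.

Lemma rnorm0_eq0 V (x : V) : rnorm x = 0 -> x = 0.
Proof.
by move=> x0; apply: normr0_eq0; rewrite -of_real_rnorm x0 of_real0.
Qed.

Lemma rnormD V (x y : V) : rnorm (x + y) <= rnorm x + rnorm y.
Proof. by rewrite /rnorm -real_partD le_real_part// ler_normD. Qed.

Lemma rnormZ V (a : K) (x : V) : rnorm (a *: x) = rnorm (a : K^o) * rnorm x.
Proof.
apply: (can_inj (@of_realK R k)).
by rewrite of_realM !of_real_rnorm normrZ.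
Qed.

End rnorm_theory.

Section dual.
Context {R : realType} {k : scalars}.
Local Notation K := (scalar_field R k).
Variable V : normedModType K.

Definition continuous_linear : {pred V -> K^o} :=
  mem [set f : V -> K^o | linear f /\ continuous f].

(* The topological dual of V. *)
Record dual := Dual {
  dual_fun :> V -> K^o ;
  dual_funP : dual_fun \in continuous_linear }.

HB.instance Definition _ := [isSub for dual_fun].
HB.instance Definition _ := [Choice of dual by <:].

Fact continuous_linear_submod_closed : submod_closed continuous_linear.
Proof.
split=> [|a f g].
  rewrite inE /=; split; last by move=> x; exact: cvg_cst.
  by move=> b x y /=; rewrite scaler0 addr0.
rewrite !inE /= => -[lf cf] [lg cg]; split.
  move=> b x y; rewrite !fctE lf lg !scalerDr !scalerA [a * b]mulrC.
  by rewrite addrACA.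
by move=> x; apply: cvgD; [apply: cvgZl_tmp; exact: cf|exact: cg].
Qed.

HB.instance Definition _ := GRing.isSubmodClosed.Build _ _ continuous_linear
  continuous_linear_submod_closed.
HB.instance Definition _ := [SubChoice_isSubLmodule of dual by <:].

End dual.

Section dual_norm.
Context {R : realType} {k : scalars}.
Local Notation K := (scalar_field R k).
Variable V : normedModType K.
Implicit Types f g : dual V.

Lemma dual_linear f : linear f.
Proof. by have := dual_funP f; rewrite inE => -[]. Qed.

Lemma dual_continuous f : continuous f.
Proof. by have := dual_funP f; rewrite inE => -[]. Qed.

HB.instance Definition _ f :=
  @GRing.isLinear.Build K V K^o *:%R f (dual_linear f).

Lemma dualP f g : f =1 g -> f = g.
Proof. by move=> fg; apply: val_inj; apply/funext. Qed.

Lemma dualDE f g x : (f + g) x = f x + g x.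
Proof. by []. Qed.

Lemma dualZE (a : K) f x : (a *: f) x = a *: f x.
Proof. by []. Qed.

Definition op_norm f : R :=
  sup [set rnorm (f x) | x in [set x : V | rnorm x <= 1]].

Lemma op_norm_has_sup f :
  has_sup [set rnorm (f x) | x in [set x : V | rnorm x <= 1]].
Proof.
split; first by exists (rnorm (f 0)), 0 => //=; rewrite rnorm0.
have /linear_bounded_continuous /linear_boundedP := @dual_continuous f.
move=> /pinfty_ex_gt0[M M0 fM].
exists (real_part M) => _ [x /= x1 <-].
apply: le_real_part; apply: (le_trans (fM x)).
rewrite -[leRHS]mulr1 ler_wpM2l ?(ltW M0)//.
by have := x1; rewrite rnorm_le of_real1.
Qed.

Lemma rnorm_le_op_norm f x : rnorm x <= 1 -> rnorm (f x) <= op_norm f.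
Proof.
by move=> x1; apply: sup_upper_bound; [exact: op_norm_has_sup|exists x].
Qed.

Lemma op_norm_le f (M : R) :
  (forall x, rnorm x <= 1 -> rnorm (f x) <= M) -> op_norm f <= M.
Proof.
move=> fM; apply: ge_sup; first exact: (op_norm_has_sup f).1.
by move=> _ [x /= x1 <-]; exact: fM.
Qed.

Lemma op_normD f g : op_norm (f + g) <= op_norm f + op_norm g.
Proof.
apply: op_norm_le => x x1; rewrite dualDE.
by apply: (le_trans (rnormD _ _)); rewrite lerD// rnorm_le_op_norm.
Qed.

Lemma op_norm_ge0 f : 0 <= op_norm f.
Proof.
by apply: le_trans (rnorm_le_op_norm f (x := 0) _); rewrite ?rnorm_ge0 ?rnorm0.
Qed.

Lemma op_norm_eq0 f : op_norm f = 0 -> f = 0.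
Proof.
move=> f0; apply: dualP => x.
have [->|x0] := eqVneq x 0; first by rewrite linear0.
have nx : `|x| != 0 by rewrite normr_eq0.
have : rnorm (f (`|x|^-1 *: x)) <= 0.
  rewrite -f0; apply: rnorm_le_op_norm.
  by rewrite rnorm_le normrZ normfV normr_id mulVf// of_real1.
rewrite linearZ rnorm_le of_real0 normr_le0.
by rewrite scaler_eq0 invr_eq0 (negbTE nx) /= => /eqP.
Qed.

Lemma op_normZ (a : K) f : op_norm (a *: f) = rnorm (a : K^o) * op_norm f.
Proof.
have leZ (b : K) (g : dual V) : op_norm (b *: g) <= rnorm (b : K^o) * op_norm g.
  apply: op_norm_le => x x1; rewrite dualZE rnormZ.
  by rewrite ler_wpM2l ?rnorm_ge0// rnorm_le_op_norm.
apply/eqP; rewrite eq_le leZ /=.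
have [->|a0] := eqVneq a 0; first by rewrite rnorm0 mul0r op_norm_ge0.
have /(ler_wpM2l (rnorm_ge0 (a : K^o))) := leZ a^-1 (a *: f).
rewrite scalerA mulVf// scale1r => /le_trans; apply.
rewrite mulrA -rnormZ -[a *: _]/(a * a^-1) mulfV//.
suff -> : rnorm (1 : K^o) = 1 by rewrite mul1r.
by rewrite /rnorm normr1 -[X in real_part X]of_real1 of_realK.
Qed.

Definition dual_norm f : K := of_real k (op_norm f).

Fact dual_normD f g : dual_norm (f + g) <= dual_norm f + dual_norm g.
Proof. by rewrite -of_realD le_of_real op_normD. Qed.

Fact dual_normZ (a : K) f : dual_norm (a *: f) = `|a| * dual_norm f.
Proof. by rewrite /dual_norm op_normZ of_realM of_real_rnorm. Qed.

Fact dual_norm0_eq0 f : dual_norm f = 0 -> f = 0.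
Proof.
move=> f0; apply: op_norm_eq0; apply: (can_inj (@of_realK R k)).
by rewrite of_real0.
Qed.

HB.instance Definition _ := @Lmodule_isNormed.Build K (dual V) dual_norm
  dual_normD dual_normZ dual_norm0_eq0.

Lemma rnorm_dualE f : rnorm f = op_norm f.
Proof. exact: of_realK. Qed.

End dual_norm.

Section sequence_norms.
Context {R : realType} {k : scalars}.
Local Notation K := (scalar_field R k).
Local Open Scope ereal_scope.

Definition sup_norm (Z : normedModType K) (z : nat -> Z) : \bar R :=
  ereal_sup [set (rnorm (z j))%:E | j in [set: nat]].

Definition power_sum (Z : normedModType K) (q : R) (z : nat -> Z) : \bar R :=
  \sum_(0 <= j <oo) ((rnorm (z j)) `^ q)%:E.

(* [lnorm q], [lwnorm q] and [lmidnorm q] are defined for 1 <= q <= +oo (the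
   value at q = -oo is junk) and equal +oo on sequences outside of the
   corresponding sequence space. *)
Definition lnorm (Z : normedModType K) (q : \bar R) (z : nat -> Z) : \bar R :=
  if q is r%:E then power_sum r z `^ r^-1 else sup_norm z.

Definition lwnorm (Z : normedModType K) (q : \bar R) (z : nat -> Z) : \bar R :=
  if q is r%:E then
    ereal_sup [set (power_sum r (fun j => phi (z j))) `^ r^-1
              | phi in [set phi : dual Z | (rnorm phi <= 1)%R]]
  else sup_norm z.

Definition mid_sum (Z : normedModType K) (q : R)
    (zs : nat -> dual Z) (z : nat -> Z) : \bar R :=
  \sum_(0 <= n <oo) power_sum q (fun j => zs n (z j)).

Definition lmidnorm (Z : normedModType K) (q : \bar R) (z : nat -> Z) : \bar R :=
  if q is r%:E then
    ereal_sup [set mid_sum r zs z `^ r^-1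
              | zs in [set zs : nat -> dual Z | lwnorm r%:E zs <= 1]]
  else sup_norm z.

Definition in_l (Z : normedModType K) (q : \bar R) (z : nat -> Z) : Prop :=
  lnorm q z < +oo.

Definition in_lw (Z : normedModType K) (q : \bar R) (z : nat -> Z) : Prop :=
  lwnorm q z < +oo.

Definition in_lmid (Z : normedModType K) (q : \bar R) (z : nat -> Z) : Prop :=
  if q is r%:E then
    forall zs : nat -> dual Z, in_lw r%:E zs -> mid_sum r zs z < +oo
  else sup_norm z < +oo.

Definition mid_summing (X Z : normedModType K) (q : \bar R) (T : X -> Z) : Prop :=
  (forall x : nat -> X, in_lmid q x -> in_l q (T \o x)) /\
  (forall x : nat -> X, in_lmid q x ->
   forall e : R, (0 < e)%R -> exists2 d : R, (0 < d)%R &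
   forall x' : nat -> X, in_lmid q x' -> lmidnorm q (x' \- x)%R < d%:E ->
     lnorm q ((T \o x') \- (T \o x))%R < e%:E).

(* The operator norm of the map induced by T from l_q^mid(X) to l_q(Z). *)
Definition mid_summing_norm (X Z : normedModType K) (q : \bar R) (T : X -> Z) :
    \bar R :=
  ereal_sup [set lnorm q (T \o x)
            | x in [set x : nat -> X | in_lmid q x /\ lmidnorm q x <= 1]].

End sequence_norms.

Section tensor_product.
Context {R : realType} {k : scalars}.
Local Notation K := (scalar_field R k).
Variables X Y : lmodType K.

Definition tensor_sum (s : seq (X * Y)) : {bilinear X -> Y -> K^o} -> K^o :=
  fun A => \sum_(p <- s) A p.1 p.2.

Definition is_tensor : {pred {bilinear X -> Y -> K^o} -> K^o} :=
  mem [set u | exists s, u = tensor_sum s].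

(* The algebraic tensor product of X and Y: the space of functionals on the
   bilinear forms on X * Y spanned by the evaluations A |-> A x y. *)
Record tensor := Tensor {
  tensor_val : {bilinear X -> Y -> K^o} -> K^o ;
  tensor_valP : tensor_val \in is_tensor }.

HB.instance Definition _ := [isSub for tensor_val].
HB.instance Definition _ := [Choice of tensor by <:].

Fact is_tensor_submod_closed : submod_closed is_tensor.
Proof.
split=> [|a u v]; rewrite !inE /=.
  by exists [::]; apply/funext => A; rewrite /tensor_sum big_nil.
move=> [s ->] [t ->].
exists ([seq (a *: p.1, p.2) | p <- s] ++ t); apply/funext => A.
rewrite /tensor_sum big_cat big_map !fctE scaler_sumr; congr (_ + _).
by apply: eq_bigr => p _; rewrite linearZl_LR.
Qed.

HB.instance Definition _ := GRing.isSubmodClosed.Build _ _ is_tensor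
  is_tensor_submod_closed.
HB.instance Definition _ := [SubChoice_isSubLmodule of tensor by <:].

Fact pure_tensor_subproof (x : X) (y : Y) :
  (fun A : {bilinear X -> Y -> K^o} => A x y) \in is_tensor.
Proof.
by rewrite inE; exists [:: (x, y)]; apply/funext => A; rewrite /tensor_sum big_seq1.
Qed.

Definition pure_tensor (x : X) (y : Y) : tensor :=
  Tensor (pure_tensor_subproof x y).

End tensor_product.

Section gamma.
Context {R : realType} {k : scalars}.
Local Notation K := (scalar_field R k).
Variables X Y : normedModType K.
Local Open Scope ereal_scope.

Definition finite_seq (Z : lmodType K) (s : seq Z) : nat -> Z :=
  fun j => nth 0%R s j.

Definition gamma_norm (p : \bar R) (u : tensor X Y) : \bar R :=
  ereal_inf [set lmidnorm (hoelder_conjugate p) (finite_seq (unzip1 s)) *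
                 lnorm p (finite_seq (unzip2 s))
            | s in [set s : seq (X * Y) |
                    u = (\sum_(v <- s) pure_tensor v.1 v.2)%R]].

(* [E], together with [iota], is a completion of the tensor product of X and Y
   endowed with the norm [gamma_norm p]; a completion is unique up to a unique
   isometric isomorphism. *)
Definition is_gamma_completion (p : \bar R) (E : completeNormedModType K)
    (iota : tensor X Y -> E) : Prop :=
  [/\ linear iota,
      forall u, (rnorm (iota u))%:E = gamma_norm p u &
      dense (range iota)].

End gamma.

(* Main.v *)
Require Import Defs.
From HB Require Import structures.
From mathcomp Require Import all_boot all_order all_algebra.
From mathcomp Require Import all_classical all_reals all_analysis.
From mathcomp Require Import complex.

Import Order.TTheory GRing.Theory Num.Theory.
Import numFieldNormedType.Exports.

Set Implicit Arguments.
Unset Strict Implicit.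
Unset Printing Implicit Defensive.

Local Open Scope classical_set_scope.
Local Open Scope ring_scope.

(* Write q for the conjugate exponent of p. If Phi is bounded, pairing a finite
   sequence (x_j) with (lambda_j y_j), where y_j in the unit ball of Y almost
   norms T x_j, gives sum_j lambda_j |T x_j| <= |Phi| |(x_j)|_q^mid |lambda|_p,
   and the converse of Hoelder's inequality yields
   |(T x_j)|_q <= |Phi| |(x_j)|_q^mid, first for finite and then for all
   sequences. Conversely, Hoelder's inequality bounds the functional induced by
   T on the algebraic tensor product by the norm of T times gamma_p, and a
   bounded functional extends from a dense subspace. The definition of
   l_q^mid(X) by pointwise finiteness implies that the mid norm is finite: if
   it were not, sequences witnessing this could be glued into a single weakly
   q-summable sequence with infinite mid sum. *)

(** * Estimates for the strong norms *)

Section sequence_norms.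
Context {R : realType} {k : scalars}.
Local Notation K := (scalar_field R k).
Implicit Types (Z : normedModType K) (q r M : R).

Lemma poweRV_le (r M : R) (x : \bar R) : 0 < r -> 0 <= M -> (0 <= x)%E ->
  (x `^ r^-1 <= M%:E)%E = (x <= (M `^ r)%:E)%E.
Proof.
move=> r0 M0; have ri0 : 0 < r^-1 by rewrite invr_gt0.
case: x => [x| |] //=; last by rewrite invr_eq0 gt_eqF.
rewrite !lee_fin => x0; apply/idP/idP => h.
- have -> : x = (x `^ r^-1) `^ r by rewrite -powRrM mulVf ?gt_eqF// powRr1.
  by apply: ge0_ler_powR; rewrite ?nnegrE ?powR_ge0// ltW.
- have -> : M = (M `^ r) `^ r^-1 by rewrite -powRrM mulfV ?gt_eqF// powRr1.
  by apply: ge0_ler_powR; rewrite ?nnegrE ?powR_ge0// ltW.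
Qed.

Lemma power_sum_ge0 Z q (z : nat -> Z) : (0 <= power_sum q z)%E.
Proof. by apply: nneseries_ge0 => n _ _; rewrite lee_fin powR_ge0. Qed.

Lemma power_sum_leP Z q M (z : nat -> Z) :
  (power_sum q z <= M%:E)%E <->
  forall n, \sum_(0 <= j < n) rnorm (z j) `^ q <= M.
Proof.
split=> [h n|h].
  rewrite -lee_fin -sumEFin; apply: le_trans h.
  by apply: nneseries_lim_ge => j _ _; rewrite lee_fin powR_ge0.
apply: lime_le.
  by apply: is_cvg_nneseries => j _ _; rewrite lee_fin powR_ge0.
by apply: nearW => n; rewrite sumEFin lee_fin.
Qed.

Lemma ler_power_sum (Z Z' : normedModType K) q (z : nat -> Z) (z' : nat -> Z') :
  0 <= q -> (forall j, rnorm (z j) <= rnorm (z' j)) ->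
  (power_sum q z <= power_sum q z')%E.
Proof.
move=> q0 h; apply: lee_nneseries => j *; rewrite lee_fin ?powR_ge0//.
by apply: ge0_ler_powR; rewrite ?nnegrE ?rnorm_ge0.
Qed.

Lemma power_sumZ Z q (a : K) (z : nat -> Z) :
  power_sum q (fun j => a *: z j) = ((rnorm (a : K^o) `^ q)%:E * power_sum q z)%E.
Proof.
rewrite /power_sum -nneseriesZl//; first last.
  by move=> i _; rewrite lee_fin powR_ge0.
apply: eq_eseriesr => j _.
by rewrite rnormZ powRM ?rnorm_ge0// EFinM.
Qed.

Lemma lnorm_ge0 Z (q : \bar R) (z : nat -> Z) : (0 <= lnorm q z)%E.
Proof.
have s0 : (0 <= sup_norm z)%E.
  apply: (@le_trans _ _ (rnorm (z 0%N))%:E); first by rewrite lee_fin rnorm_ge0.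
  by apply: ereal_sup_ubound; exists 0%N.
by case: q => [r| |]//=; exact: poweR_ge0.
Qed.

Lemma sup_norm_leP Z (M : R) (z : nat -> Z) :
  (sup_norm z <= M%:E)%E <-> forall j, rnorm (z j) <= M.
Proof.
split=> [h j|h].
  by rewrite -lee_fin; apply: le_trans h; apply: ereal_sup_ubound; exists j.
by apply: ge_ereal_sup => _ [j _ <-]; rewrite lee_fin.
Qed.

Lemma lnorm_leP Z (r M : R) (z : nat -> Z) : 0 < r -> 0 <= M ->
  (lnorm r%:E z <= M%:E)%E <->
  forall n, \sum_(0 <= j < n) rnorm (z j) `^ r <= M `^ r.
Proof.
by move=> r0 M0; rewrite /= poweRV_le ?power_sum_ge0//; exact: power_sum_leP.
Qed.

Lemma lnormZ_le Z (q : \bar R) (M : R) (a : K) (z : nat -> Z) :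
  (1 <= q)%E -> 0 <= M -> (lnorm q z <= M%:E)%E ->
  (lnorm q (fun j => a *: z j) <= (rnorm (a : K^o) * M)%:E)%E.
Proof.
case: q => [r| |]//.
- rewrite lee_fin => r1 M0.
  have r0 : 0 < r by exact: lt_le_trans r1.
  rewrite /= !poweRV_le ?power_sum_ge0 ?mulr_ge0 ?rnorm_ge0//.
  rewrite power_sumZ powRM ?rnorm_ge0// EFinM => h.
  by apply: lee_pmul => //; rewrite ?power_sum_ge0// lee_fin powR_ge0.
- move=> _ M0 /= /sup_norm_leP h; apply/sup_norm_leP => j.
  by rewrite rnormZ ler_wpM2l ?rnorm_ge0.
Qed.

Lemma ler_lnorm (Z Z' : normedModType K) (q : \bar R) (z : nat -> Z)
    (z' : nat -> Z') : (1 <= q)%E -> (forall j, rnorm (z j) <= rnorm (z' j)) ->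
  (lnorm q z <= lnorm q z')%E.
Proof.
case: q => [r| |] q1 zz'; last discriminate q1.
  have r0 : 0 <= r by rewrite lee_fin in q1; exact: le_trans q1.
  apply: gt0_ler_poweR; rewrite ?invr_ge0 ?in_itv/= ?andbT ?power_sum_ge0 ?leey//.
  exact: ler_power_sum.
apply: ge_ereal_sup => _ [j _ <-]; apply: (@le_trans _ _ (rnorm (z' j))%:E).
  by rewrite lee_fin.
by apply: ereal_sup_ubound; exists j.
Qed.

Lemma power_sum_finite_seq Z r (s : seq Z) : 0 < r ->
  power_sum r (Defs.finite_seq s) =
  (\sum_(0 <= j < size s) rnorm s`_j `^ r)%:E.
Proof.
move=> r0; rewrite /power_sum (@nneseries_split _ _ 0 (size s)) => [|j _]; last first.
  by rewrite lee_fin powR_ge0.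
rewrite add0n sumEFin eseries0 ?adde0// => j sj _.
by rewrite /Defs.finite_seq nth_default// rnorm0 powR0// gt_eqF.
Qed.

Lemma lnorm_finite_seq_lty Z (q : \bar R) (s : seq Z) : (1 <= q)%E ->
  (lnorm q (Defs.finite_seq s) < +oo)%E.
Proof.
case: q => [r| |]//.
- rewrite lee_fin => r1.
  by rewrite /= power_sum_finite_seq ?poweR_lty ?ltry//; exact: lt_le_trans r1.
- move=> _ /=.
  apply: (@le_lt_trans _ _ (\sum_(0 <= j < size s) rnorm (s`_j))%:E);
    last exact: ltry.
  apply/sup_norm_leP => j.
  have [sj|js] := leqP (size s) j.
    rewrite /Defs.finite_seq nth_default// rnorm0.
    by apply: sumr_ge0 => i _; exact: rnorm_ge0.
  rewrite big_mkord (bigD1 (Ordinal js))//= lerDl.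
  by apply: sumr_ge0 => i _; exact: rnorm_ge0.
Qed.

Lemma rnorm_le_lnorm Z (q : \bar R) M (z : nat -> Z) j : (1 <= q)%E -> 0 <= M ->
  (lnorm q z <= M%:E)%E -> rnorm (z j) <= M.
Proof.
case: q => [r| |]// r1 M0; last by move=> /sup_norm_leP.
have r0 : 0 < r by rewrite lee_fin in r1; exact: lt_le_trans r1.
move=> /lnorm_leP => /(_ r0 M0 j.+1).
rewrite big_nat_recr//= => h.
have {h} : (rnorm (z j) `^ r) <= M `^ r.
  by apply: le_trans h; rewrite lerDr sumr_ge0// => i _; exact: powR_ge0.
by apply: contra_le => /gt0_ltr_powR; apply; rewrite ?nnegrE ?rnorm_ge0.
Qed.

End sequence_norms.

(** * Scalars, dual norms and the embedding into the bidual *)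

Section duality.
Context {R : realType} {k : scalars}.
Local Notation K := (scalar_field R k).
Implicit Types V : normedModType K.

Lemma rnorm_of_real (a : R) : 0 <= a -> rnorm (of_real k a : K^o) = a.
Proof.
move=> a0; apply: (can_inj (@of_realK R k)); rewrite of_real_rnorm ger0_norm//.
by rewrite -(@of_real0 R k) le_of_real.
Qed.

Lemma rnormV (a : K) : rnorm (a^-1 : K^o) = (rnorm (a : K^o))^-1.
Proof.
apply: (can_inj (@of_realK R k)).
have [->|a0] := eqVneq a 0; first by rewrite invr0 rnorm0 invr0.
have ra0 : rnorm (a : K^o) != 0 by apply: contra_neq a0; exact: rnorm0_eq0.
congr of_real; apply: (mulIf ra0); rewrite -rnormZ mulVf//.
rewrite -[_ *: _]/(a^-1 * a) mulVf// -(@of_real1 R k).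
by rewrite (rnorm_of_real ler01).
Qed.

Lemma rnorm_normalize V (x : V) :
  rnorm x != 0 -> rnorm (of_real k (rnorm x)^-1 *: x) = 1.
Proof.
by move=> x0; rewrite rnormZ rnorm_of_real ?invr_ge0 ?rnorm_ge0// mulVf.
Qed.

Lemma rnorm_dual_le V (f : dual V) x : rnorm (f x) <= rnorm f * rnorm x.
Proof.
have [/rnorm0_eq0 ->|x0] := eqVneq (rnorm x) 0.
  by rewrite linear0 !rnorm0 mulr0.
have := @rnorm_le_op_norm _ _ _ f _ (eq_ind_r (fun t => t <= 1) (lexx 1)
  (rnorm_normalize x0)).
rewrite linearZ/= rnormZ rnorm_of_real ?invr_ge0 ?rnorm_ge0// -rnorm_dualE.
by rewrite mulrC ler_pdivrMr// lt_neqAle eq_sym x0 rnorm_ge0.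
Qed.

Lemma bounded_linear_dual V (f : V -> K^o) (C : R) : linear f ->
  (forall x, rnorm (f x) <= C * rnorm x) -> exists phi : dual V, phi =1 f.
Proof.
move=> lf fC.
pose fl := GRing.isLinear.Build _ _ _ _ f lf.
pose F : {linear V -> K^o} := HB.pack f fl.
suff cf : continuous (F : V -> K^o).
  have fP : f \in @continuous_linear R k V by rewrite inE.
  by exists (Dual fP).
apply: bounded_linear_continuous; apply/linear_boundedP.
near=> M => x; apply: (@le_trans _ _ (of_real k C * `|x|)).
  by rewrite -!of_real_rnorm -of_realM le_of_real fC.
apply: ler_wpM2r => //; apply: ltW.
by near: M; apply: nbhs_pinfty_gt; case: (k) => //=; rewrite ?num_real// complex_real.
Unshelve. all: by end_near. Qed.

(** The canonical embedding into the bidual; the bound on [phi] is just [|f x| <= |f| |x|], whereas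
    equality would be the Hahn-Banach half. *)
Lemma bidual_eval V (x : V) : exists2 phi : dual (dual V),
  (forall f, phi f = f x) & rnorm phi <= rnorm x.
Proof.
have [|f|phi phiE] := @bounded_linear_dual (dual V) (fun f => f x) (rnorm x).
- by move=> a f g.
- by rewrite mulrC rnorm_dual_le.
exists phi => //; rewrite rnorm_dualE; apply: op_norm_le => f f1.
rewrite phiE; apply: le_trans (rnorm_dual_le _ _) _.
by rewrite ler_piMl ?rnorm_ge0.
Qed.

End duality.

(** * Weak and mid norms *)

Section mid_norm.
Context {R : realType} {k : scalars}.
Local Notation K := (scalar_field R k).
Implicit Types (Z : normedModType K) (r M : R).

Lemma mid_sum_ge0 Z r (zs : nat -> dual Z) (z : nat -> Z) :
  (0 <= mid_sum r zs z)%E.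
Proof. by apply: nneseries_ge0 => n _ _; exact: power_sum_ge0. Qed.

Lemma lwnorm_leP Z r M (z : nat -> Z) : 0 < r -> 0 <= M ->
  (lwnorm r%:E z <= M%:E)%E <->
  forall phi : dual Z, rnorm phi <= 1 ->
    (power_sum r (fun j => phi (z j)) <= (M `^ r)%:E)%E.
Proof.
move=> r0 M0; split=> [h phi phi1|h].
  rewrite -poweRV_le ?power_sum_ge0//; apply: le_trans h.
  by apply: ereal_sup_ubound; exists phi.
apply: ge_ereal_sup => _ [phi phi1 <-].
by rewrite poweRV_le ?power_sum_ge0//; exact: h.
Qed.

Lemma lmidnorm_leP Z r M (z : nat -> Z) : 0 < r -> 0 <= M ->
  (lmidnorm r%:E z <= M%:E)%E <->
  forall zs : nat -> dual Z, (lwnorm r%:E zs <= 1)%E ->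
    (mid_sum r zs z <= (M `^ r)%:E)%E.
Proof.
move=> r0 M0; split=> [h zs zs1|h].
  rewrite -poweRV_le ?mid_sum_ge0//; apply: le_trans h.
  by apply: ereal_sup_ubound; exists zs.
apply: ge_ereal_sup => _ [zs zs1 <-].
by rewrite poweRV_le ?mid_sum_ge0//; exact: h.
Qed.

Lemma lmidnorm_ge0 Z (q : \bar R) (z : nat -> Z) : (1 <= q)%E ->
  (0 <= lmidnorm q z)%E.
Proof.
case: q => [r| |]// r1; last exact: (lnorm_ge0 +oo).
have r0 : 0 < r by rewrite lee_fin in r1; exact: lt_le_trans r1.
(* The zero sequence of functionals is admissible in the supremum. *)
apply: le_trans (poweR_ge0 (mid_sum r (fun=> 0) z) r^-1) _.
apply: ereal_sup_ubound; exists (fun=> 0) => //=.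
apply/(lwnorm_leP _ r0 ler01) => phi _.
rewrite /power_sum eseries0 ?lee_fin ?powR_ge0// => i _ _.
by rewrite linear0 rnorm0 powR0// gt_eqF.
Qed.

Lemma mid_sumZ Z r (a : K) (zs : nat -> dual Z) (z : nat -> Z) :
  mid_sum r zs (fun j => a *: z j) =
  ((rnorm (a : K^o) `^ r)%:E * mid_sum r zs z)%E.
Proof.
rewrite /mid_sum -nneseriesZl; last by move=> *; exact: power_sum_ge0.
apply: eq_eseriesr => n _; rewrite -power_sumZ.
by apply: eq_eseriesr => j _; rewrite linearZ.
Qed.

Lemma mid_sumZl Z r (a : K) (zs : nat -> dual Z) (z : nat -> Z) :
  mid_sum r (fun n => a *: zs n) z =
  ((rnorm (a : K^o) `^ r)%:E * mid_sum r zs z)%E.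
Proof.
rewrite /mid_sum -nneseriesZl; last by move=> *; exact: power_sum_ge0.
by apply: eq_eseriesr => n _; rewrite -power_sumZ.
Qed.

Lemma ler_mid_sum Z r (zs : nat -> dual Z) (z z' : nat -> Z) : 0 <= r ->
  (forall n j, rnorm (zs n (z j)) <= rnorm (zs n (z' j))) ->
  (mid_sum r zs z <= mid_sum r zs z')%E.
Proof.
move=> r0 h; apply: lee_nneseries => n *; first exact: power_sum_ge0.
exact: ler_power_sum.
Qed.

Lemma lmidnormZ_le Z (q : \bar R) M (a : K) (z : nat -> Z) :
  (1 <= q)%E -> 0 <= M -> (lmidnorm q z <= M%:E)%E ->
  (lmidnorm q (fun j => a *: z j) <= (rnorm (a : K^o) * M)%:E)%E.
Proof.
case: q => [r| |]// r1 M0; last exact: (lnormZ_le (q := +oo)).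
have r0 : 0 < r by rewrite lee_fin in r1; exact: lt_le_trans r1.
move=> /lmidnorm_leP h; apply/lmidnorm_leP => [//||zs zs1].
  by rewrite mulr_ge0 ?rnorm_ge0.
rewrite mid_sumZ powRM ?rnorm_ge0// EFinM.
by apply: lee_wpmul2l; rewrite ?lee_fin ?powR_ge0//; exact: h.
Qed.

Lemma in_lmidZ Z (q : \bar R) (a : K) (z : nat -> Z) : (1 <= q)%E ->
  in_lmid q z -> in_lmid q (fun j => a *: z j).
Proof.
case: q => [r| |] q1; last discriminate q1.
  move=> /= h zs /h hz; rewrite mid_sumZ.
  by rewrite lte_mul_pinfty// lee_fin powR_ge0.
move=> /= h; have h0 := lnorm_ge0 +oo z.
apply: (@le_lt_trans _ _ (rnorm (a : K^o) * fine (sup_norm z))%:E); last first.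
  exact: ltry.
apply: (lnormZ_le (q := +oo)) => //=; first by rewrite fine_ge0.
by rewrite fineK// ge0_fin_numE.
Qed.

(** The weak norm of [zs] is a supremum over the unit ball of the bidual, which contains evaluation
    at [z / |z|]; homogeneity restores the factor [|z|]. *)
Lemma lwnorm_eval_le Z r M (zs : nat -> dual Z) (z : Z) : 0 < r -> 0 <= M ->
  (lwnorm r%:E zs <= M%:E)%E ->
  (power_sum r (fun n => zs n z) <= ((M * rnorm z) `^ r)%:E)%E.
Proof.
move=> r0 M0 h.
have [/rnorm0_eq0 ->|z0] := eqVneq (rnorm z) 0.
  rewrite /power_sum eseries0 ?lee_fin ?powR_ge0// => i _ _.
  by rewrite linear0 rnorm0 powR0// gt_eqF.
have [phi phiE phi1] := bidual_eval (of_real k (rnorm z)^-1 *: z).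
rewrite rnorm_normalize// in phi1.
have := (lwnorm_leP zs r0 M0).1 h phi phi1.
have -> : (fun n => phi (zs n)) = (fun n => of_real k (rnorm z)^-1 *: zs n z).
  by apply/funext => n; rewrite phiE linearZ.
rewrite power_sumZ rnorm_of_real ?invr_ge0 ?rnorm_ge0// => {}h.
rewrite mulrC powRM ?rnorm_ge0// EFinM -lee_pdivrMl//; last first.
  by rewrite powR_gt0// lt_neqAle eq_sym z0 rnorm_ge0.
by move: h; rewrite -(powR_inv1 (rnorm_ge0 _)) -(powR_inv1 (powR_ge0 _ _)) powRAC.
Qed.

End mid_norm.

(** * Strong summability implies mid summability; finiteness of the mid norm *)

Section mid_norm_finiteness.
Context {R : realType} {k : scalars}.
Local Notation K := (scalar_field R k).
Implicit Types (Z : normedModType K) (r M : R).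

(** Tonelli: with the sum over [n] taken first, [lwnorm_eval_le] applies at each [z j]. *)
Lemma mid_sum_le_power_sum Z r M (zs : nat -> dual Z) (z : nat -> Z) :
  0 < r -> 0 <= M -> (lwnorm r%:E zs <= M%:E)%E ->
  (mid_sum r zs z <= (M `^ r)%:E * power_sum r z)%E.
Proof.
move=> r0 M0 h; rewrite /mid_sum /power_sum nneseries_interchange; last first.
  by move=> i j; rewrite lee_fin powR_ge0.
rewrite -nneseriesZl; last by move=> j _; rewrite lee_fin powR_ge0.
apply: lee_nneseries => [j _ _|j _].
  exact: (power_sum_ge0 r (fun n => zs n (z j))).
by rewrite -EFinM -powRM ?rnorm_ge0//; exact: lwnorm_eval_le.
Qed.

Lemma in_l_in_lmid Z (q : \bar R) (z : nat -> Z) :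
  (1 <= q)%E -> in_l q z -> in_lmid q z.
Proof.
case: q => [r| |]//; rewrite lee_fin => r1.
have r0 : 0 < r by exact: lt_le_trans r1.
rewrite /in_l /= => /lty_poweRy; rewrite invr_eq0 gt_eqF// => /(_ isT) zy zs.
rewrite /in_lw => zsy.
have zs0 : (0 <= lwnorm r%:E zs)%E.
  apply: le_trans (poweR_ge0 (power_sum r (fun n => (0 : dual (dual Z)) (zs n))) r^-1) _.
  by apply: ereal_sup_ubound; exists 0 => //=; rewrite rnorm0.
apply: (@le_lt_trans _ _ ((fine (lwnorm r%:E zs) `^ r)%:E * power_sum r z)%E).
  apply: mid_sum_le_power_sum => //; first by rewrite fine_ge0.
  by rewrite fineK// ge0_fin_numE.
by rewrite lte_mul_pinfty// lee_fin powR_ge0.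
Qed.

Lemma in_lmid_finite_seq Z (q : \bar R) (s : seq Z) :
  (1 <= q)%E -> in_lmid q (Defs.finite_seq s).
Proof. by move=> q1; apply/in_l_in_lmid/lnorm_finite_seq_lty. Qed.

Lemma finite_seq_mkseq Z (x : nat -> Z) n j :
  Defs.finite_seq (mkseq x n) j = if (j < n)%N then x j else 0.
Proof.
rewrite /Defs.finite_seq; case: ltnP => jn; first by rewrite nth_mkseq.
by rewrite nth_default// size_mkseq.
Qed.

(** Replacing terms by zero can only decrease each mid sum. This passes from infinite sequences to
    the finite ones that represent tensors. *)
Lemma lmidnorm_truncate Z (q : \bar R) M (x : nat -> Z) n : (1 <= q)%E ->
  0 <= M -> (lmidnorm q x <= M%:E)%E ->
  (lmidnorm q (Defs.finite_seq (mkseq x n)) <= M%:E)%E.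
Proof.
case: q => [r| |] q1 M0; last discriminate q1.
  have r0 : 0 < r by rewrite lee_fin in q1; exact: lt_le_trans q1.
  move=> /lmidnorm_leP h; apply/lmidnorm_leP => // zs zs1.
  apply: le_trans (h r0 M0 zs zs1); apply: ler_mid_sum; first exact: ltW.
  move=> m j; rewrite finite_seq_mkseq; case: ifP => // _.
  by rewrite linear0 rnorm0 rnorm_ge0.
move=> /sup_norm_leP h; apply/sup_norm_leP => j.
by rewrite finite_seq_mkseq; case: ifP => // _; rewrite rnorm0.
Qed.

(** For nonnegative terms both sides are the same unordered sum over [nat * nat]. *)
Lemma nneseries_reindex2 (F : nat * nat -> \bar R) (e : nat -> nat * nat) :
  (forall i, (0 <= F i)%E) -> set_bij setT setT e ->
  (\sum_(0 <= i <oo) F (e i) = \sum_(0 <= m <oo) \sum_(0 <= n <oo) F (m, n))%E.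
Proof.
move=> F0 be; rewrite nneseries_esumT//.
rewrite -(reindex_esum setT setT e F)//.
rewrite [RHS]nneseries_esumT; last by move=> m; exact: nneseries_ge0.
under [RHS]eq_esum do rewrite nneseries_esumT//.
rewrite (@esum_esum _ _ _ setT (fun=> setT) (fun m n => F (m, n)))//.
rewrite (_ : _ `*`` _ = setT); first by apply: eq_esum => -[].
by apply/seteqP; split.
Qed.

(** Weights of total mass 1, so that gluing countably many sequences of weak norm at most 1 stays in
    the unit ball. *)
Let weight m : R := 2^-1 ^+ m.+1.

Let weight_ge0 m : 0 <= weight m.
Proof. by rewrite exprn_ge0. Qed.

(** The weights lie in (0, 1], so raising them to a power [r >= 1] only decreases them, and the
    geometric series remains. *)
Let sum_weight r : 1 <= r -> (\sum_(0 <= m <oo) (weight m `^ r)%:E <= 1)%E.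
Proof.
move=> r1; apply: lime_le.
  by apply: is_cvg_nneseries => m _ _; rewrite lee_fin powR_ge0.
apply: nearW => n; rewrite sumEFin lee_fin.
apply: (@le_trans _ _ (\sum_(0 <= m < n) weight m)).
  apply: ler_sum => m _; apply: ge1r_powR => //.
  by rewrite exprn_gt0//= exprn_ile1// invf_le1// ler1n.
suff -> : \sum_(0 <= m < n) weight m = 1 - 2^-1 ^+ n.
  by rewrite lerBlDr lerDl exprn_ge0.
elim: n => [|n ih]; first by rewrite big_nil expr0 subrr.
rewrite big_nat_recr//= ih /weight exprS.
by rewrite {1}[2^-1 ^+ n]splitr opprD addrA mulrC subrK.
Qed.

(* [w] enumerates the elements [2^-(m+1) zs m n] along a bijection of [nat] with
   [nat * nat]. *)
Lemma weak_gluing Z r (zs : nat -> nat -> dual Z) : 1 <= r ->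
  (forall m, lwnorm r%:E (zs m) <= 1)%E ->
  exists2 w : nat -> dual Z, (lwnorm r%:E w <= 1)%E &
  forall z m, ((weight m `^ r)%:E * mid_sum r (zs m) z <= mid_sum r w z)%E.
Proof.
move=> r1 zs1; have r0 : 0 < r by exact: lt_le_trans r1.
have /card_esym/ppcard_eqP[e] := card_nat2.
have be : set_bij setT setT (e : nat -> nat * nat) by exact: bij.
pose w mn := of_real k (weight mn.1) *: zs mn.1 mn.2.
exists (w \o e).
  apply/(lwnorm_leP _ r0 ler01) => phi phi1; rewrite powR1.
  rewrite /power_sum.
  rewrite (@nneseries_reindex2 (fun mn => (rnorm (phi (w mn)) `^ r)%:E))//;
    last by move=> i; rewrite lee_fin powR_ge0.
  apply: le_trans (sum_weight r1); apply: lee_nneseries => m _.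
    by move=> _; apply: nneseries_ge0 => *; rewrite lee_fin powR_ge0.
  rewrite -/(power_sum r (fun n => phi (w (m, n)))).
  rewrite (_ : (fun n => _) = fun n => of_real k (weight m) *: phi (zs m n)).
    rewrite power_sumZ rnorm_of_real// -[leRHS]mule1.
    apply: lee_wpmul2l; first by rewrite lee_fin powR_ge0.
    by have := (lwnorm_leP _ r0 ler01).1 (zs1 m) phi phi1; rewrite powR1.
  by apply/funext => n; rewrite /w linearZ.
move=> z m.
have -> : mid_sum r (w \o e) z = (\sum_(0 <= m <oo) mid_sum r (fun n => w (m, n)) z)%E.
  apply: (@nneseries_reindex2 (fun mn => power_sum r (fun j => w mn (z j)))) be.
  by move=> i; exact: power_sum_ge0.
(* Only block [m] is kept; the other blocks are nonnegative. *)
rewrite (nneseriesD1 (n := m))//; last by move=> *; exact: mid_sum_ge0.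
rewrite -[in leLHS](@rnorm_of_real R k _ (weight_ge0 m)) -mid_sumZl leeDl//.
by apply: nneseries_ge0 => *; exact: mid_sum_ge0.
Qed.

Lemma in_lmid_lmidnorm_lty Z (q : \bar R) (z : nat -> Z) : (1 <= q)%E ->
  in_lmid q z -> (lmidnorm q z < +oo)%E.
Proof.
case: q => [r| |]//; rewrite lee_fin => r1 zr.
have r0 : 0 < r by exact: lt_le_trans r1.
apply: contrapT => /negP; rewrite -leNgt leye_eq => /eqP zy.
(* The threshold already includes the weight that block [m] receives in the gluing, so the glued mid
   sum will exceed every integer. *)
have big_zs m : exists zs : nat -> dual Z, (lwnorm r%:E zs <= 1)%E /\
    ((m%:R)%:E < (weight m `^ r)%:E * mid_sum r zs z)%E.
  apply: contrapT => /forallNP h.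
  have : (lmidnorm r%:E z <= ((m%:R / (weight m `^ r)) `^ r^-1)%:E)%E.
    apply/lmidnorm_leP; rewrite ?powR_ge0// => zs zs1.
    rewrite -powRrM mulVf ?gt_eqF// powRr1 ?divr_ge0 ?powR_ge0//.
    rewrite mulrC EFinM lee_pdivlMl; last by rewrite powR_gt0 ?exprn_gt0.
    by have /not_andP[//|/negP] := h zs; rewrite -leNgt.
  by rewrite zy leye_eq.
have [zs zsP] := choice big_zs.
have [m|w w1 wP] := weak_gluing r1 (zs := zs); first by case: (zsP m).
have wy : (mid_sum r w z < +oo)%E by apply: zr; exact: le_lt_trans (ltry 1).
have wfin : mid_sum r w z \is a fin_num by rewrite ge0_fin_numE ?mid_sum_ge0.
pose n := Num.bound (fine (mid_sum r w z)).
have nlt : fine (mid_sum r w z) < n%:R.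
  by apply: archi_boundP; rewrite fine_ge0 ?mid_sum_ge0.
have [_] := zsP n; rewrite ltNge => /negP; apply.
by apply: le_trans (wP z n) _; rewrite -(fineK wfin) lee_fin ltW.
Qed.

End mid_norm_finiteness.

(** * Hoelder's inequality and its converse for sequences of functionals *)

Section hoelder.
Context {R : realType} {k : scalars}.
Local Notation K := (scalar_field R k).
Implicit Types (Y Z : normedModType K) (p : \bar R) (r s M : R).

Lemma hoelder_conjugate_cases p : (1 <= p)%E ->
  [\/ p = +oo%E /\ hoelder_conjugate p = 1%E,
      p = 1%E /\ hoelder_conjugate p = +oo%E |
      exists r s, [/\ 1 < r, 1 < s, r^-1 + s^-1 = 1,
        p = r%:E & hoelder_conjugate p = s%:E]].
Proof.
case: p => [r| |] r1; last discriminate r1; last by constructor 1.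
move: r1; rewrite le_eqVlt => /predU1P[<-|].
  by constructor 2; rewrite hoelder_conjugate1.
rewrite lte_fin => r1; constructor 3.
have r0 : r != 0 by rewrite gt_eqF// (lt_trans ltr01).
have r10 : r - 1 != 0 by rewrite subr_eq0 gt_eqF.
exists r, (r / (r - 1)); split => //.
- by rewrite ltr_pdivlMr ?subr_gt0// mul1r ltrBlDl ltrDr.
- by rewrite invf_div -[X in X + _]mul1r -mulrDl addrC subrK mulfV.
- rewrite /hoelder_conjugate/= eqe (negbTE r0).
  by rewrite -EFinD inver (negbTE r10).
Qed.

(** At the endpoints one factor is bounded uniformly; in between, Young's inequality is summed over
    the terms normalized by [A] and [B]. *)
Lemma hoelder_sum p (Z Z' : normedModType K) (A B : R)
    (a : nat -> Z) (b : nat -> Z') n : (1 <= p)%E -> 0 <= A -> 0 <= B ->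
  (lnorm (hoelder_conjugate p) a <= A%:E)%E -> (lnorm p b <= B%:E)%E ->
  \sum_(0 <= j < n) rnorm (a j) * rnorm (b j) <= A * B.
Proof.
(* The pairing of exponents 1 and infinity, used for both endpoints with the roles of [a] and [b]
   exchanged. *)
have case1 (V V' : normedModType K) (u : nat -> V) (v : nat -> V') C D :
    0 <= C -> 0 <= D -> (lnorm 1%E u <= C%:E)%E -> (sup_norm v <= D%:E)%E ->
    \sum_(0 <= j < n) rnorm (u j) * rnorm (v j) <= C * D.
  move=> C0 D0 /lnorm_leP => /(_ ltr01 C0 n); rewrite powRr1//.
  move=> uC /sup_norm_leP vD.
  apply: (@le_trans _ _ (\sum_(0 <= j < n) rnorm (u j) * D)).
    by apply: ler_sum => j _; rewrite ler_wpM2l ?rnorm_ge0.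
  rewrite -mulr_suml ler_wpM2r//; apply: le_trans uC.
  by apply: ler_sum => j _; rewrite powRr1 ?rnorm_ge0.
move=> p1 A0 B0 aA bB.
case: (hoelder_conjugate_cases p1) => [[pE qE]|[pE qE]|[r [s [r1 s1 rs pE qE]]]].
- by apply: case1 => //; [rewrite -qE|move: bB; rewrite pE].
- rewrite mulrC; under eq_bigr do rewrite mulrC.
  by apply: case1 => //; [rewrite -pE|move: aA; rewrite qE].
have q1 : (1 <= hoelder_conjugate p)%E by rewrite qE lee_fin ltW.
have r0 : 0 < r by exact: lt_trans r1.
have s0 : 0 < s by exact: lt_trans s1.
(* Normalization divides by [A] and [B]; if one of them is zero, all products vanish. *)
have [A00|A_neq0] := eqVneq A 0.
  rewrite big1 => [|j _]; first by rewrite mulr_ge0.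
  have /eqP -> : rnorm (a j) == 0; last by rewrite mul0r.
  by rewrite eq_le rnorm_ge0 andbT -A00; exact: (rnorm_le_lnorm j q1 A0 aA).
have [B00|B_neq0] := eqVneq B 0.
  rewrite big1 => [|j _]; first by rewrite mulr_ge0.
  have /eqP -> : rnorm (b j) == 0; last by rewrite mulr0.
  by rewrite eq_le rnorm_ge0 andbT -B00; exact: (rnorm_le_lnorm j p1 B0 bB).
have {A_neq0}A_gt0 : 0 < A by rewrite lt_neqAle eq_sym A_neq0.
have {B_neq0}B_gt0 : 0 < B by rewrite lt_neqAle eq_sym B_neq0.
have normalized (V : normedModType K) (u : nat -> V) (t C : R) : 0 < t -> 0 < C ->
    (lnorm t%:E u <= C%:E)%E -> \sum_(0 <= j < n) (rnorm (u j) / C) `^ t <= 1.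
  move=> t0 C0 /lnorm_leP => /(_ t0 (ltW C0) n) uC.
  under eq_bigr do rewrite powRM ?rnorm_ge0 ?invr_ge0 ?(ltW C0)//.
  rewrite -mulr_suml -powR_inv1 ?(ltW C0)// powRAC powR_inv1 ?powR_ge0//.
  by rewrite ler_pdivrMr ?mul1r// powR_gt0.
rewrite -[leRHS]mulr1 -ler_pdivrMl ?mulr_gt0// mulr_sumr.
(* Young's inequality termwise; the two normalized sums are at most 1, which leaves
   [s^-1 + r^-1 = 1]. *)
apply: (@le_trans _ _ (\sum_(0 <= j < n)
    ((rnorm (a j) / A) `^ s / s + (rnorm (b j) / B) `^ r / r))).
  apply: ler_sum => j _; rewrite invfM mulrACA ![_^-1 * _]mulrC.
  apply: conjugate_powR; rewrite ?divr_ge0 ?rnorm_ge0//.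
  by rewrite addrC.
rewrite big_split/= -!mulr_suml -[1 in leRHS]rs addrC.
apply: lerD; rewrite ler_piMl ?invr_ge0 ?(ltW r0) ?(ltW s0)//.
- by apply: normalized; rewrite -?pE.
- by apply: normalized; rewrite -?qE.
Qed.

Lemma op_norm_adherent Y (f : dual Y) (e : R) : 0 < e ->
  exists y : Y, rnorm y <= 1 /\ rnorm f - e <= rnorm (f y).
Proof.
move=> e0; have [_ [y y1 <-]] := sup_adherent e0 (op_norm_has_sup f).
by rewrite rnorm_dualE => /ltW; exists y.
Qed.

(** Unit-ball vectors almost norming each [t j], scaled by [l j], form an admissible test sequence.
    The weights stay free so that each exponent can choose its own extremal ones. *)
Lemma weighted_sum_dual_le Y p (t : nat -> dual Y) M n (l : nat -> R) (B : R) :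
  (forall (y : nat -> Y) (B' : R), 0 <= B' ->
    (lnorm p (Defs.finite_seq (mkseq y n)) <= B'%:E)%E ->
    \sum_(0 <= j < n) rnorm (t j (y j)) <= M * B') ->
  (forall j, 0 <= l j) -> 0 <= B ->
  (forall y : nat -> Y, (forall j, rnorm (y j) <= l j) ->
    (lnorm p (Defs.finite_seq (mkseq y n)) <= B%:E)%E) ->
  \sum_(0 <= j < n) l j * rnorm (t j) <= M * B.
Proof.
move=> tM l0 B0 lB; apply/ler_addgt0Pr => e e0.
pose L := \sum_(0 <= j < n) l j.
have L0 : 0 <= L by exact: sumr_ge0.
(* The defects add up to [L * (e / (L + 1)) <= e]; the [+ 1] covers the case of zero weights. *)
have eL : 0 < e / (L + 1) by rewrite divr_gt0// ltr_wpDl.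
have [y yP] := choice (fun j => op_norm_adherent (t j) eL).
pose x j := of_real k (l j) *: y j.
have xl j : rnorm (x j) <= l j.
  by rewrite rnormZ rnorm_of_real// ler_piMr//; case: (yP j).
apply: (@le_trans _ _ (\sum_(0 <= j < n) rnorm (t j (x j)) + e)); last first.
  by rewrite lerD2r; apply: tM => //; exact: lB.
apply: (@le_trans _ _ (\sum_(0 <= j < n)
    (rnorm (t j (x j)) + l j * (e / (L + 1))))).
  apply: ler_sum => j _; rewrite linearZ rnormZ rnorm_of_real// -mulrDr.
  by rewrite ler_wpM2l// -lerBlDr; case: (yP j).
rewrite big_split/= lerD2l -mulr_suml -/L mulrCA ler_piMr ?(ltW e0)//.
by rewrite ler_pdivrMr ?mul1r ?lerDl// ltr_wpDl.
Qed.

Lemma lnorm_dual_le Y p (t : nat -> dual Y) M : (1 <= p)%E -> 0 <= M ->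
  (forall n (y : nat -> Y) (B : R), 0 <= B ->
    (lnorm p (Defs.finite_seq (mkseq y n)) <= B%:E)%E ->
    \sum_(0 <= j < n) rnorm (t j (y j)) <= M * B) ->
  (lnorm (hoelder_conjugate p) t <= M%:E)%E.
Proof.
move=> p1 M0 tM.
have lnorm_mkseq_le (y : nat -> Y) (r B : R) n : 0 < r -> 0 <= B ->
    \sum_(0 <= j < n) rnorm (y j) `^ r <= B `^ r ->
    (lnorm r%:E (Defs.finite_seq (mkseq y n)) <= B%:E)%E.
  move=> r0 B0 yB; rewrite /= poweRV_le ?power_sum_ge0//.
  rewrite power_sum_finite_seq// lee_fin size_mkseq; apply: le_trans yB.
  rewrite le_eqVlt; apply/orP; left; apply/eqP.
  by apply: eq_big_nat => j /andP[_ jn]; rewrite nth_mkseq.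
case: (hoelder_conjugate_cases p1) => [[pE ->]|[pE ->]|[r [s [r1 s1 rs pE ->]]]].
- apply/lnorm_leP => // n; rewrite powRr1//.
  have := weighted_sum_dual_le (tM n) (l := fun=> 1) (fun=> ler01) ler01.
  rewrite mulr1; under eq_bigr do rewrite mul1r.
  under [in X in _ -> is_true X]eq_bigr do rewrite powRr1 ?rnorm_ge0//.
  apply=> y y1; rewrite pE; apply/sup_norm_leP => j.
  by rewrite finite_seq_mkseq; case: ifP => // _; rewrite rnorm0.
- apply/sup_norm_leP => i.
  (* Length [i.+1] is the shortest that contains index [i], where the point mass sits. *)
  have := weighted_sum_dual_le (tM i.+1) (l := fun j => (j == i)%:R)
    (fun=> ler0n _ _) ler01.
  rewrite mulr1 big_nat_recr//= eqxx mul1r big_nat_cond big1 ?add0r => [|j]; last first.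
    by move=> /andP[/andP[_ ji] _]; rewrite ltn_eqF// mul0r.
  apply=> y y1; rewrite pE; apply: lnorm_mkseq_le => //; rewrite powR1.
  apply: (@le_trans _ _ (\sum_(0 <= j < i.+1) (j == i)%:R)).
    by apply: ler_sum => j _; rewrite powRr1 ?rnorm_ge0.
  rewrite big_nat_recr//= eqxx big_nat_cond big1 ?add0r// => j.
  by move=> /andP[/andP[_ ji] _]; rewrite ltn_eqF.
have r0 : 0 < r by exact: lt_trans r1.
have s0 : 0 < s by exact: lt_trans s1.
apply/lnorm_leP => // n; set S := (X in X <= _).
have S0 : 0 <= S by apply: sumr_ge0 => j _; exact: powR_ge0.
have [->|S_neq0] := eqVneq S 0; first exact: powR_ge0.
have S_gt0 : 0 < S by rewrite lt_neqAle eq_sym S_neq0.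
have sr : (s - 1) * r = s.
  have -> : s - 1 = s * r^-1 by rewrite -[r^-1](addrK s^-1) rs mulrBr mulr1 mulfV ?gt_eqF.
  by rewrite mulfVK// gt_eqF.
have : S <= M * S `^ r^-1.
  have := weighted_sum_dual_le (tM n) (l := fun j => rnorm (t j) `^ (s - 1))
    (fun=> powR_ge0 _ _) (powR_ge0 S r^-1).
  under eq_bigr do rewrite mulrC mulr_powRB1 ?rnorm_ge0//.
  apply=> y yl; rewrite pE; apply: lnorm_mkseq_le; rewrite ?powR_ge0//.
  rewrite -powRrM mulVf ?gt_eqF// powRr1//; apply: ler_sum => j _.
  rewrite -[in leRHS]sr powRrM; apply: ge0_ler_powR; rewrite ?nnegrE ?rnorm_ge0 ?powR_ge0//.
  exact: ltW.
rewrite -[X in X <= _](powRr1 S0) -rs addrC powRD; last by rewrite S_neq0 implybT.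
rewrite ler_pM2r ?powR_gt0// => h.
have -> : S = (S `^ s^-1) `^ s by rewrite -powRrM mulVf ?gt_eqF// powRr1.
by apply: ge0_ler_powR; rewrite ?nnegrE ?powR_ge0// ltW.
Qed.

End hoelder.

(** * Extension of bounded functionals from a dense subspace *)

Section dense_extension.
Context {R : realType} {k : scalars}.
Local Notation K := (scalar_field R k).

Lemma rnormN (V : normedModType K) (x : V) : rnorm (- x) = rnorm x.
Proof. by rewrite /rnorm normrN. Qed.

Lemma rnorm_distC (V : normedModType K) (x y : V) : rnorm (x - y) = rnorm (y - x).
Proof. by rewrite -rnormN opprB. Qed.

Lemma le0_linear_bound (x c : R) : (forall d, 0 < d -> x <= c * d) -> x <= 0.
Proof.
move=> xc; apply/ler_addgt0Pr => e e0; rewrite add0r.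
have c1 : 0 < `|c| + 1 by rewrite ltr_wpDl.
apply: le_trans (xc (e / (`|c| + 1)) _) _; first by rewrite divr_gt0.
rewrite mulrCA ler_piMr ?(ltW e0)// ler_pdivrMr// mul1r.
by rewrite (le_trans (ler_norm c))// lerDl.
Qed.

Lemma dense_approx (E : normedModType K) (A : set E) (e : E) (d : R) :
  dense A -> 0 < d -> exists2 a, A a & rnorm (a - e) < d.
Proof.
move=> dA d0.
have od : 0 < of_real k d.
  by rewrite lt_neqAle -{2}(@of_real0 R k) le_of_real ltW// andbT -(@of_real0 R k)
    (inj_eq (can_inj (@of_realK R k))) lt_eqF.
have [|a [ea Aa]] := dA (ball e (of_real k d)) _ (ball_open _ _).
  by exists e; exact: ballxx.
exists a => //; move: ea; rewrite -ball_normE /= -of_real_rnorm rnorm_distC.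
rewrite lt_neqAle le_of_real (inj_eq (can_inj (@of_realK R k))).
by rewrite -lt_neqAle.
Qed.

(* McShane's formula [sup_w (g w - d w)] produces the value of the extension
   without any appeal to completeness. *)
Lemma real_limit (W : Type) (g d : W -> R) :
  (forall v w, `|g v - g w| <= d v + d w) ->
  exists l, forall w, `|g w - l| <= d w.
Proof.
move=> gd; have [[w0 _]|W0] := pselect (exists w : W, True); last first.
  by exists 0 => w; case: W0; exists w.
pose A := range (fun w => g w - d w).
have gdle v w : g v - d v <= g w + d w.
  rewrite lerBlDr -addrA [d w + _]addrC -lerBlDl.
  by apply: le_trans (ler_norm _) (gd v w).
have supA : has_sup A.
  by split; [exists (g w0 - d w0), w0|exists (g w0 + d w0) => _ [v _ <-]].
exists (sup A) => w; rewrite ler_distl; apply/andP; split.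
  by rewrite lerBlDr; apply: ge_sup => [|_ [v _ <-]]; [exact: supA.1|exact: gdle].
by rewrite -lerBlDr; apply: (sup_upper_bound supA); exists w.
Qed.

(** Over the complex numbers [real_limit] is applied to the real and imaginary parts; recombining
    them costs the factor 2. *)
Lemma scalar_limit (W : Type) (a : W -> K^o) (d : W -> R) :
  (forall v w, rnorm (a v - a w) <= d v + d w) ->
  exists l : K^o, forall w, rnorm (a w - l) <= 2 * d w.
Proof.
case: k a => /= a ad.
  have [l lP] := real_limit ad; exists l => w; apply: le_trans (lP w) _.
  by rewrite ler_peMl ?ler1n// (le_trans (normr_ge0 _) (lP w)).
have rnormE (z : R[i]) : rnorm (z : (scalar_field R ComplexScalars)^o) =
    Num.sqrt (complex.Re z ^+ 2 + complex.Im z ^+ 2).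
  by have /= h := congr1 (@complex.Re R) (normc_def z); exact: h.
have re_le (z : R[i]) :
    `|complex.Re z| <= rnorm (z : (scalar_field R ComplexScalars)^o).
  by rewrite rnormE -sqrtr_sqr ler_wsqrtr// lerDl sqr_ge0.
have im_le (z : R[i]) :
    `|complex.Im z| <= rnorm (z : (scalar_field R ComplexScalars)^o).
  by rewrite rnormE -sqrtr_sqr ler_wsqrtr// lerDr sqr_ge0.
have le_re_im (z : R[i]) : rnorm (z : (scalar_field R ComplexScalars)^o) <=
    `|complex.Re z| + `|complex.Im z|.
  rewrite rnormE -[leRHS]ger0_norm ?addr_ge0// -sqrtr_sqr ler_wsqrtr//.
  by rewrite sqrrD !real_normK ?num_real// addrAC lerDl mulrn_wge0 ?mulr_ge0.
have [v w|l lP] := @real_limit W (fun w => complex.Re (a w)) d.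
  by apply: le_trans (ad v w); apply: le_trans (re_le _); case: (a v) (a w) => ? ? [].
have [v w|l' lP'] := @real_limit W (fun w => complex.Im (a w)) d.
  by apply: le_trans (ad v w); apply: le_trans (im_le _); case: (a v) (a w) => ? ? [].
exists (Complex l l') => w; apply: le_trans (le_re_im _) _.
rewrite mulr2n mulrDl mul1r; apply: le_trans (lerD (lP w) (lP' w)).
by case: (a w).
Qed.

(** The value at [e] is a scalar within [2 * C * |iota w - e|] of every [f w]. Taking [iota w = e]
    shows that it extends [f], and density gives linearity. The constant 2 is not sharp;
    [le_rnorm_dual_dense] later gives the exact norm. *)
Lemma dense_extension (W : lmodType K) (E : normedModType K) (iota : W -> E)
    (f : W -> K^o) (C : R) :
  linear iota -> dense (range iota) -> linear f -> 0 <= C ->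
  (forall w, rnorm (f w) <= C * rnorm (iota w)) ->
  exists Phi : dual E, forall w, Phi (iota w) = f w.
Proof.
move=> li di lf C0 fC.
pose iotaL : {linear W -> E} := HB.pack iota (GRing.isLinear.Build _ _ _ _ iota li).
pose fL : {linear W -> K^o} := HB.pack f (GRing.isLinear.Build _ _ _ _ f lf).
have limit e : exists l : K^o, forall w, rnorm (f w - l) <= 2 * (C * rnorm (iota w - e)).
  apply: scalar_limit => v w.
  rewrite -[f v - f w](linearB fL) -mulrDr; apply: le_trans (fC _) _.
  rewrite ler_wpM2l// [iota _](linearB iotaL)/= -(subrKA e).
  by rewrite (le_trans (rnormD _ _))// [rnorm (e - _)]rnorm_distC.
have [Phi] := choice limit; set D := 2 * C => PhiP.
have {}PhiP e w : rnorm (f w - Phi e) <= D * rnorm (iota w - e).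
  by rewrite -mulrA.
have D0 : 0 <= D by rewrite mulr_ge0.
have PhiE w : Phi (iota w) = f w.
  apply/esym/eqP; rewrite -subr_eq0; apply/eqP/rnorm0_eq0/eqP.
  rewrite eq_le rnorm_ge0 andbT.
  by have := PhiP (iota w) w; rewrite subrr rnorm0 mulr0.
have Phi_linear : linear Phi.
  move=> b e e'; apply/eqP; rewrite -subr_eq0; apply/eqP/rnorm0_eq0/eqP.
  rewrite eq_le rnorm_ge0 andbT.
  (* Both sides of the linearity equation are compared with [f (b *: w + w')] for [d]-approximations
     [w], [w']; each comparison costs [D * (|b| + 1) * d]. *)
  apply: (@le0_linear_bound _ (2 * D * (rnorm (b : K^o) + 1))) => d d0.
  have [_ [w _ <-] /ltW wd] := dense_approx e di d0.
  have [_ [w' _ <-] /ltW wd'] := dense_approx e' di d0.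
  have bd : rnorm (b : K^o) * rnorm (iota w - e) + rnorm (iota w' - e') <=
            (rnorm (b : K^o) + 1) * d.
    by rewrite mulrDl mul1r lerD// ler_wpM2l ?rnorm_ge0.
  have h1 : rnorm (f (b *: w + w') - Phi (b *: e + e')) <= D * ((rnorm (b : K^o) + 1) * d).
    apply: le_trans (PhiP _ _) _; rewrite ler_wpM2l// li opprD addrACA -scalerBr.
    by apply: le_trans (rnormD _ _) _; rewrite rnormZ.
  have h2 : rnorm (f (b *: w + w') - (b *: Phi e + Phi e')) <=
            D * ((rnorm (b : K^o) + 1) * d).
    rewrite lf opprD addrACA -scalerBr.
    apply: le_trans (rnormD _ _) _; rewrite rnormZ.
    apply: le_trans (ler_wpM2l D0 bd); rewrite mulrDr; apply: lerD => //.
    by rewrite mulrCA ler_wpM2l ?rnorm_ge0.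
  rewrite -(subrKA (f (b *: w + w'))) (le_trans (rnormD _ _))//.
  rewrite rnorm_distC -!mulrA mulr_natl mulr2n.
  by apply: lerD; rewrite mulrA.
have [e|phi phiE] := @bounded_linear_dual R k E Phi D Phi_linear.
  (* Boundedness is the approximation property at [w = 0]. *)
  have := PhiP e 0.
  by rewrite [f 0](linear0 fL) [iota 0](linear0 iotaL) !sub0r !rnormN.
by exists phi => w; rewrite phiE.
Qed.

End dense_extension.

(** * Operators into the dual versus functionals on tensors *)

Section representation.
Context {R : realType} {k : scalars}.
Local Notation K := (scalar_field R k).
Implicit Types (X Y Z : normedModType K) (p q : \bar R).

(** Rotating each [y j] by such a phase turns a sum of scalars into a sum of moduli without
    increasing the norms. *)
Lemma phase_exists (a : K^o) : exists theta : K,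
  rnorm (theta : K^o) <= 1 /\ theta *: a = of_real k (rnorm a).
Proof.
have [->|a0] := eqVneq a 0.
  by exists 0; rewrite scale0r !rnorm0 of_real0.
exists (of_real k (rnorm a) / a); split; last first.
  by rewrite -[LHS]/(_ / a * a) mulfVK.
by rewrite rnorm_le of_real1 normrM normfV of_real_rnorm normr_id mulfV ?normr_eq0.
Qed.

Lemma big_mkseq (V : nmodType) (T : Type) (g : nat -> T) (F : T -> V) n :
  \sum_(v <- mkseq g n) F v = \sum_(0 <= j < n) F (g j).
Proof. by rewrite /mkseq big_map /index_iota subn0. Qed.

Lemma homogeneous_bound X Z q (T : {linear X -> Z}) (d N : R) :
  (1 <= q)%E -> 0 < d -> 0 <= N ->
  (forall x, in_lmid q x -> (lmidnorm q x <= d%:E)%E ->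
    (lnorm q (T \o x) <= N%:E)%E) ->
  forall M x, 0 <= M -> in_lmid q x -> (lmidnorm q x <= M%:E)%E ->
    (lnorm q (T \o x) <= (N / d * M)%:E)%E.
Proof.
move=> q1 d0 N0 dN M x M0 xq xM.
have Nd0 : 0 <= N / d by rewrite divr_ge0// ltW.
apply/lee_addgt0Pr => e e0.
(* A slight enlargement of [M] makes division possible when [M = 0] and changes the bound by at most
   [e]. *)
pose M' := M + e / (N / d + 1).
have M'0 : 0 < M' by rewrite ltr_wpDl// divr_gt0// ltr_wpDl.
have dM'0 : 0 < d / M' by rewrite divr_gt0.
pose a := of_real k (d / M').
have aE : rnorm (a : K^o) = d / M' by rewrite rnorm_of_real// ltW.
have a0 : a != 0.
  apply/eqP => a0; have := aE; rewrite a0 rnorm0 => /esym/eqP.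
  by rewrite gt_eqF.
have /dN : (lmidnorm q (fun j => a *: x j) <= d%:E)%E.
  apply: le_trans (lmidnormZ_le a q1 M0 xM) _.
  rewrite lee_fin aE mulrAC ler_pdivrMr// ler_wpM2l ?(ltW d0)//.
  by rewrite lerDl ltW// divr_gt0// ltr_wpDl.
move=> /(_ (in_lmidZ a q1 xq)) /(lnormZ_le a^-1 q1 N0).
rewrite (_ : (fun j => _) = T \o x); last first.
  by apply/funext => j /=; rewrite linearZ scalerA mulVf// scale1r.
move=> /le_trans; apply; rewrite -EFinD lee_fin.
rewrite rnormV aE invf_div mulrAC -mulrA [M' * _]mulrC /M' mulrDr lerD2l.
rewrite mulrCA ler_piMr ?(ltW e0)// ler_pdivrMr ?mul1r ?lerDl//.
by rewrite ltr_wpDl.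
Qed.

(** For a representation of [u] that almost attains the infimum, [|f u|] is at most the sum of
    [|T x_j| |y_j|], and Hoelder's inequality applies. *)
Lemma gamma_norm_functional_le X Y p (f : {linear tensor X Y -> K^o})
    (T : X -> dual Y) (N : R) : (1 <= p)%E -> 0 <= N ->
  (forall x y, f (pure_tensor x y) = T x y) ->
  (forall M s, 0 <= M ->
    (lmidnorm (hoelder_conjugate p) (Defs.finite_seq s) <= M%:E)%E ->
    (lnorm (hoelder_conjugate p) (T \o Defs.finite_seq s) <= (N * M)%:E)%E) ->
  forall u (g : R), gamma_norm p u = g%:E -> rnorm (f u) <= N * g.
Proof.
move=> p1 N0 fT TN u g ug; have q1 := hoelder_conj_ge1 p1.
apply/ler_addgt0Pr => e e0.
have eN : 0 < e / (N + 1) by rewrite divr_gt0// ltr_wpDl.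
have ufin : gamma_norm p u \is a fin_num by rewrite ug.
have [_ [s /= us <-]] := lb_ereal_inf_adherent eN ufin.
rewrite -/(gamma_norm p u) ug -EFinD => slt.
have Afin : lmidnorm (hoelder_conjugate p) (Defs.finite_seq (unzip1 s)) \is a fin_num.
  rewrite ge0_fin_numE ?lmidnorm_ge0//.
  exact/in_lmid_lmidnorm_lty/in_lmid_finite_seq.
have Bfin : lnorm p (Defs.finite_seq (unzip2 s)) \is a fin_num.
  by rewrite ge0_fin_numE ?lnorm_ge0// lnorm_finite_seq_lty.
move: slt; rewrite -(fineK Afin) -(fineK Bfin) -EFinM lte_fin.
set A := fine _; set B := fine _ => AB.
have A0 : 0 <= A by rewrite fine_ge0// lmidnorm_ge0.
have B0 : 0 <= B by rewrite fine_ge0// lnorm_ge0.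
apply: (@le_trans _ _ (N * A * B)); last first.
  apply: (@le_trans _ _ (N * (g + e / (N + 1)))).
    by rewrite -mulrA ler_wpM2l// ltW.
  rewrite mulrDr lerD2l mulrCA ler_piMr ?(ltW e0)//.
  by rewrite ler_pdivrMr ?mul1r ?lerDl// ltr_wpDl.
have := @hoelder_sum R k p _ _ (N * A) B (T \o Defs.finite_seq (unzip1 s))
  (Defs.finite_seq (unzip2 s)) (size s) p1 (mulr_ge0 N0 A0) B0.
rewrite fineK// => /(_ _ (lexx _)); rewrite TN ?fineK// => /(_ isT).
apply: le_trans; rewrite us raddf_sum.
elim: s {us A B Afin Bfin AB A0 B0} => [|[x y] s ih]; first by rewrite !big_nil rnorm0.
rewrite big_cons/= big_nat_recl//; apply: le_trans (rnormD _ _) _.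
by rewrite fT lerD// rnorm_dual_le.
Qed.

(** By converse Hoelder it suffices to bound the sum of [|T x_j y_j|] over [j < n]. With phases
    [theta j] this is [Phi] at the tensor with terms [x_j], [theta j *: y_j], whose gamma norm is
    bounded by this very representation. *)
Lemma lnorm_le_of_functional X Y p (E : completeNormedModType K)
    (iota : tensor X Y -> E) (Phi : dual E) (T : X -> dual Y) (M : R)
    (x : nat -> X) : (1 <= p)%E -> is_gamma_completion p iota ->
  (forall x y, Phi (iota (pure_tensor x y)) = T x y) ->
  0 <= M -> (lmidnorm (hoelder_conjugate p) x <= M%:E)%E ->
  (lnorm (hoelder_conjugate p) (T \o x) <= (rnorm Phi * M)%:E)%E.
Proof.
move=> p1 [li iotaE _] PhiT M0 xM; have q1 := hoelder_conj_ge1 p1.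
apply: lnorm_dual_le; rewrite ?mulr_ge0 ?rnorm_ge0// => n y B B0 yB.
have [theta thetaP] := choice (fun j => phase_exists (T (x j) (y j))).
pose iotaL : {linear tensor X Y -> E} :=
  HB.pack iota (GRing.isLinear.Build _ _ _ _ iota li).
pose s := mkseq (fun j => (x j, theta j *: y j)) n.
pose u := \sum_(v <- s) pure_tensor v.1 v.2.
have PhiuE : Phi (iota u) = of_real k (\sum_(0 <= j < n) rnorm (T (x j) (y j))).
  rewrite -[iota u]/(iotaL u) /u big_mkseq !raddf_sum/=.
  rewrite (big_morph _ (@of_realD R k) (@of_real0 R k)).
  by apply: eq_bigr => j _; rewrite PhiT linearZ/=; case: (thetaP j).
rewrite -[leLHS](@rnorm_of_real R k) -?PhiuE ?sumr_ge0// => [|j _]; last first.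
  exact: rnorm_ge0.
apply: le_trans (rnorm_dual_le _ _) _; rewrite -mulrA ler_wpM2l ?rnorm_ge0//.
rewrite -lee_fin iotaE EFinM.
apply: (@le_trans _ _ (lmidnorm (hoelder_conjugate p) (Defs.finite_seq (unzip1 s))
  * lnorm p (Defs.finite_seq (unzip2 s)))%E).
  by apply: ereal_inf_lbound; exists s.
have -> : unzip1 s = mkseq x n by rewrite /unzip1 -map_comp.
have -> : unzip2 s = mkseq (fun j => theta j *: y j) n by rewrite /unzip2 -map_comp.
apply: lee_pmul; rewrite ?lmidnorm_ge0 ?lnorm_ge0//; first exact: lmidnorm_truncate.
apply: le_trans (ler_lnorm p1 _) yB => j; rewrite !finite_seq_mkseq.
case: ifP => // _; rewrite rnormZ ler_piMl ?rnorm_ge0//.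
by case: (thetaP j).
Qed.

(** Tensors are functionals on bilinear forms, so evaluating them at this form defines the
    functional of [T]. *)
Lemma dual_of_linear_bilinear X Y (T : {linear X -> dual Y}) :
  exists A : {bilinear X -> Y -> K^o}, forall x y, A x y = T x y.
Proof.
have bT : bilinear_for *:%R *:%R (fun x y => T x y : K^o).
  split=> [y a x x'|x a y y']; first by rewrite linearP.
  by rewrite linearP.
pose A : {bilinear X -> Y -> K^o} := HB.pack (fun x y => T x y : K^o)
  (bilinear_isBilinear.Build K X Y K^o *:%R *:%R (fun x y => T x y) bT).
by exists A.
Qed.

End representation.

(** * Exact norms and the representation theorem *)

Lemma le_rnorm_dual_dense (R : realType) (k : scalars)
    (E : normedModType (scalar_field R k)) (A : set E) (Phi : dual E) (N : R) :
  dense A -> 0 <= N -> (forall a, A a -> rnorm (Phi a) <= N * rnorm a) ->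
  rnorm Phi <= N.
Proof.
move=> dA N0 PhiN; rewrite rnorm_dualE; apply: op_norm_le => x x1.
(* Replacing [x] by a [d]-close [a] in [A] costs [|Phi| * d] in the value and [N * d] in the
   bound. *)
rewrite -subr_le0; apply: (@le0_linear_bound _ _ (N + rnorm Phi)) => d d0.
have [a Aa /ltW ad] := dense_approx x dA d0.
have xa : rnorm (Phi (x - a)) <= rnorm Phi * d.
  apply: le_trans (rnorm_dual_le _ _) _.
  by rewrite ler_wpM2l ?rnorm_ge0// rnorm_distC.
have a1d : rnorm a <= 1 + d.
  by rewrite -[a in leLHS](subrK x) addrC (le_trans (rnormD _ _))// lerD.
rewrite lerBlDr -(subrK a x) linearD; apply: le_trans (rnormD _ _) _.
rewrite (_ : _ + N = rnorm Phi * d + N * (1 + d)); last first.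
  by rewrite mulrDl mulrDr mulr1 addrAC addrC [N * d + N]addrC.
by apply: lerD => //; rewrite (le_trans (PhiN _ Aa))// ler_wpM2l.
Qed.

Lemma lmidnorm_finite_seq_nil (R : realType) (k : scalars)
    (Z : normedModType (scalar_field R k)) (q : \bar R) : (1 <= q)%E ->
  (lmidnorm q (Defs.finite_seq ([::] : seq Z)) <= 0)%E.
Proof.
move=> q1; set x := Defs.finite_seq _.
have xfin : lmidnorm q x \is a fin_num.
  rewrite ge0_fin_numE ?lmidnorm_ge0//.
  exact/in_lmid_lmidnorm_lty/in_lmid_finite_seq.
(* The zero sequence is 0 times itself, so homogeneity with scalar 0 applies. *)
have := @lmidnormZ_le _ _ _ q (fine (lmidnorm q x)) 0 x q1.
rewrite rnorm0 mul0r fineK// fine_ge0 ?lmidnorm_ge0// => /(_ isT (lexx _)).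
congr (lmidnorm _ _ <= _)%E.
by apply/funext => j; rewrite scale0r /x /Defs.finite_seq nth_nil.
Qed.

Theorem theorem3p7 (R : realType) (k : scalars)
    (X Y : completeNormedModType (scalar_field R k))
    (p : \bar R) (p_ge1 : (1 <= p)%E)
    (E : completeNormedModType (scalar_field R k))
    (iota : tensor X Y -> E)
    (E_completion : is_gamma_completion p iota)
    (T : {linear X -> dual Y}) :
  (mid_summing (hoelder_conjugate p) T <->
   exists Phi : dual E, forall x y, Phi (iota (pure_tensor x y)) = T x y) /\
  (forall Phi : dual E,
     (forall x y, Phi (iota (pure_tensor x y)) = T x y) ->
     ((rnorm Phi)%:E = mid_summing_norm (hoelder_conjugate p) T)%E).
Proof.
have q1 := hoelder_conj_ge1 p_ge1; set q := hoelder_conjugate p in q1 *.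
have [iota_linear iotaE iota_dense] := E_completion.
split; first split.
- move=> [_ cT].
  pose x0 : nat -> X := Defs.finite_seq [::].
  have x0E : x0 = fun=> 0 by apply/funext => j; rewrite /x0 /Defs.finite_seq nth_nil.
  (* Continuity at the zero sequence, with tolerance 1; halving [d] below turns its strict
     inequality into a closed ball. *)
  have [d d0 dT] := cT x0 (in_lmid_finite_seq [::] q1) 1 ltr01.
  have d20 : 0 < d / 2 by rewrite divr_gt0.
  have T1 x : in_lmid q x -> (lmidnorm q x <= (d / 2)%:E)%E ->
      (lnorm q (T \o x) <= 1%:E)%E.
    move=> xq xd; apply/ltW.
    have := dT x xq; rewrite (_ : x \- x0 = x); last first.
      by apply/funext => j; rewrite x0E /= subr0.
    rewrite (_ : (T \o x) \- (T \o x0) = T \o x); last first.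
      by apply/funext => j; rewrite x0E /= linear0 subr0.
    apply; apply: le_lt_trans xd _.
    by rewrite lte_fin ltr_pdivrMr// ltr_pMr// ltr1n.
  have TN := homogeneous_bound q1 d20 ler01 T1.
  have [A AE] := dual_of_linear_bilinear T.
  pose f (u : tensor X Y) : (scalar_field R k)^o := tensor_val u A.
  have f_linear : linear f by [].
  pose fL : {linear tensor X Y -> (scalar_field R k)^o} :=
    HB.pack f (GRing.isLinear.Build _ _ _ _ f f_linear).
  have N0 : 0 <= 1 / (d / 2) by rewrite divr_ge0// ltW.
  have [|Phi PhiE] := dense_extension iota_linear iota_dense f_linear N0.
    move=> u; apply: (gamma_norm_functional_le (f := fL) p_ge1 N0 (T := T)).
    + by move=> x y; exact: AE.
    + by move=> M s M0; apply: TN => //; exact: in_lmid_finite_seq.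
    + by rewrite iotaE.
  by exists Phi => x y; rewrite PhiE; exact: AE.
- move=> [Phi PhiT].
  (* Since the mid norm is finite on [in_lmid], [fine] loses nothing here. *)
  have TPhi x : in_lmid q x ->
      (lnorm q (T \o x) <= (rnorm Phi * fine (lmidnorm q x))%:E)%E.
    move=> xq; apply: (lnorm_le_of_functional p_ge1 E_completion PhiT).
      by rewrite fine_ge0// lmidnorm_ge0.
    by rewrite fineK// ge0_fin_numE ?lmidnorm_ge0// in_lmid_lmidnorm_lty.
  split=> [x xq|x xq e e0].
    by apply: le_lt_trans (TPhi x xq) _; rewrite ltry.
  have P1 : 0 < rnorm Phi + 1 by rewrite ltr_wpDl ?rnorm_ge0.
  exists (e / (rnorm Phi + 1)) => [|x' xq' xx']; first by rewrite divr_gt0.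
  (* By linearity the bound on the difference gives continuity at every [x]. *)
  rewrite (_ : _ \- _ = T \o (x' \- x)); last first.
    by apply/funext => j; rewrite /= linearB.
  have h : (lnorm q (T \o (x' \- x)%R) <= (rnorm Phi * (e / (rnorm Phi + 1)))%:E)%E.
    apply: (lnorm_le_of_functional p_ge1 E_completion PhiT); last exact: ltW.
    by rewrite divr_ge0// ltW.
  apply: le_lt_trans h _; rewrite lte_fin mulrCA gtr_pMr//.
  by rewrite ltr_pdivrMr ?mul1r ?ltrDl.
- move=> Phi PhiT.
  have le_Phi : (mid_summing_norm q T <= (rnorm Phi)%:E)%E.
    apply: ge_ereal_sup => _ [x [xq x1] <-]; rewrite -[rnorm Phi]mulr1.
    exact: (lnorm_le_of_functional p_ge1 E_completion PhiT).
  have norm_ge0 : (0 <= mid_summing_norm q T)%E.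
    apply: le_trans (lnorm_ge0 q (T \o Defs.finite_seq [::])) _.
    apply: ereal_sup_ubound; exists (Defs.finite_seq [::]) => //.
    split; first exact: in_lmid_finite_seq.
    by apply: le_trans (lmidnorm_finite_seq_nil X q1) _.
  have norm_fin : mid_summing_norm q T \is a fin_num.
    by rewrite ge0_fin_numE// (le_lt_trans le_Phi)// ltry.
  apply/eqP; rewrite eq_le le_Phi andbT -(fineK norm_fin) lee_fin.
  have N0 : 0 <= fine (mid_summing_norm q T) by rewrite fine_ge0.
  have T1 x : in_lmid q x -> (lmidnorm q x <= 1%:E)%E ->
      (lnorm q (T \o x) <= (fine (mid_summing_norm q T))%:E)%E.
    by move=> xq x1; rewrite fineK//; apply: ereal_sup_ubound; exists x.
  have := homogeneous_bound q1 ltr01 N0 T1; rewrite divr1 => TN.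
  have f_linear : linear (Phi \o iota : _ -> (scalar_field R k)^o).
    by move=> a u v; rewrite /= iota_linear linearP.
  pose f : {linear tensor X Y -> (scalar_field R k)^o} :=
    HB.pack (Phi \o iota) (GRing.isLinear.Build _ _ _ _ _ f_linear).
  (* On the dense image of [iota] the norm is [gamma_norm], so Hoelder's bound there gives
     [|Phi| <= mid_summing_norm q T]. *)
  apply: (le_rnorm_dual_dense iota_dense) => // _ [u _ <-].
  apply: (gamma_norm_functional_le (f := f) p_ge1 N0 (T := T)) => //.
  by move=> M s M0; apply: TN => //; exact: in_lmid_finite_seq.
Qed.
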